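(* For each $n$ let $\mathbf{p}=\mathbf{p}^{(n)}=\{p_{ij}\}_{i,j\in[n]}$ be a collection of edge probabilities and let $s=s_n\in[0,1]$, and let $(G_1,G_2)$ be a pair of correlated inhomogeneous random graphs on $[n]$ with parameters $(\mathbf{p},s)$ and latent permutation $\pi_*$. Let $p_{\max}:=\max_{i,j\in[n]}p_{ij}$. Suppose that $p_{\max}\le n^{-\alpha+o(1)}$ for some constant $\alpha\in(1/2,1]$ and that $k>12/(2\alpha-1)$ is a constant positive integer. Furthermore, suppose that there exists a constant $\epsilon>0$ such that $$\min_{i\in[n]}\sum_{j=1}^n p_{ij}s^2\ge(1+\epsilon)\log n .$$ Let $(\widehat M_k,\widehat\mu_k)$ be the $k$-core estimator of $(G_1,G_2)$. Then $\mathbb{P}(\widehat\mu_k=\pi_* )=1-o(1)$ as $n\to\infty$ (where $\widehat\mu_k=\pi_*$ means $\widehat M_k=[n]$ and $\widehat\mu_k(i)=\pi_*(i)$ for all $i$).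
   Context: Edge probabilities: $\mathbf{p}=\{p_{ij}\}_{i,j\in[n]}$ with $p_{ij}\in[0,1]$, $p_{ij}=p_{ji}$, $p_{ii}=0$. The inhomogeneous random graph with parameter $\mathbf{p}$ is the simple undirected random graph on $[n]$ in which each edge $\{i,j\}$ is present with probability $p_{ij}$, independently over unordered pairs. Correlated inhomogeneous random graphs with parameters $(\mathbf{p},s)$: generate an inhomogeneous random graph $G$ with parameter $\mathbf{p}$; conditionally on $G$, generate $G_1$ and $G_2'$ independently, each keeping every edge of $G$ independently with probability $s$ (same vertex set $[n]$); finally let $\pi_*$ be an independent uniformly random permutation of $[n]$ and let $G_2$ be $G_2'$ with vertices relabelled by $\pi_*$, so that $\{\pi_*(i),\pi_*(j)\}$ is an edge of $G_2$ iff $\{i,j\}$ is an edge of $G_2'$. A matching is a pair $(M,\mu)$ with $M\subseteq[n]$ and $\mu:M\to[n]$ injective. $G_1\wedge_\mu G_2$ is the graph on vertex set $M$ in which $\{i,j\}$ is an edge iff $\{i,j\}$ is an edge of $G_1$ and $\{\mu(i),\mu(j)\}$ is an edge of $G_2$. A matching is a $k$-core matching if every vertex of $G_1\wedge_\mu G_2$ has degree at least $k$ (the empty matching qualifies vacuously). The $k$-core estimator $(\widehat M_k,\widehat\mu_k)$ is a $k$-core matching of $(G_1,G_2)$ with $|M|$ as large as possible among all $k$-core matchings (ties broken arbitrarily). The notation $p_{\max}\le n^{-\alpha+o(1)}$ means $p_{\max}\le n^{-\alpha+\varepsilon_n}$ for some deterministic sequence $\varepsilon_n\to0$. *)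

(* Defs.v *)
From mathcomp Require Import all_boot all_order all_algebra all_fingroup.
From mathcomp Require Import reals.
Set Implicit Arguments.
Unset Strict Implicit.
Unset Printing Implicit Defensive.
Import Order.TTheory GRing.Theory Num.Theory.
Local Open Scope ring_scope.

(* The unordered pair {i, j} is encoded by the ordered pair (i, j) with i < j,
   so that a simple undirected graph on [n] is an arbitrary set of edges. *)
Definition edge (n : nat) := {e : 'I_n * 'I_n | (e.1 < e.2)%N}.

Definition graph (n : nat) := {set edge n}.

Definition adj (n : nat) (G : graph n) (i j : 'I_n) : bool :=
  [exists e in G, (val e == (i, j)) || (val e == (j, i))].

Definition relabel (n : nat) (pi : 'S_n) (G : graph n) : graph n :=
  [set e : edge n | adj G ((pi^-1)%g (val e).1) ((pi^-1)%g (val e).2)].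

Definition edge_probs (R : realType) (n : nat) (p : 'I_n -> 'I_n -> R) : Prop :=
  [/\ forall i j, 0 <= p i j <= 1, forall i j, p i j = p j i
    & forall i, p i i = 0].

(* The default value 0 is neutral since edge probabilities are nonnegative. *)
Definition p_max (R : realType) (n : nat) (p : 'I_n -> 'I_n -> R) : R :=
  \big[Num.max/0]_(i < n) \big[Num.max/0]_(j < n) p i j.

(* Mass function of the random subset of T to which each x belongs with
   probability q x, independently over x. *)
Definition random_subset_law (R : realType) (T : finType) (q : T -> R)
    (A : {set T}) : R :=
  \prod_(x : T) (if x \in A then q x else 1 - q x).

Definition irg_law (R : realType) (n : nat) (p : 'I_n -> 'I_n -> R)
    (G : graph n) : R :=
  random_subset_law (fun e : edge n => p (val e).1 (val e).2) G.

(* An edge absent from G is kept with probability 0. *)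
Definition subsample_law (R : realType) (n : nat) (s : R) (G H : graph n) : R :=
  random_subset_law (fun e : edge n => if e \in G then s else 0) H.

(* An outcome is (G, G_1, G_2', pi_* ). *)
Definition outcome (n : nat) : finType :=
  (graph n * graph n * graph n * 'S_n)%type.

Definition corr_law (R : realType) (n : nat) (p : 'I_n -> 'I_n -> R) (s : R)
    (w : outcome n) : R :=
  let: (G, G1, G2', pi) := w in
  irg_law p G * subsample_law s G G1 * subsample_law s G G2' / (n`!)%:R.

(* Probability of an event A about (G_1, G_2, pi_* ). *)
Definition corr_prob (R : realType) (n : nat) (p : 'I_n -> 'I_n -> R) (s : R)
    (A : graph n -> graph n -> 'S_n -> bool) : R :=
  \sum_(w : outcome n |
        let: (_, G1, G2', pi) := w in A G1 (relabel pi G2') pi) corr_law p s w.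

(* The values of mfun outside mdom are junk: nothing below depends on them. *)
Record matching (n : nat) := Matching {
  mdom : {set 'I_n};
  mfun : 'I_n -> 'I_n;
  mfun_inj : {in mdom &, injective mfun}
}.

Definition wedge (n : nat) (G1 G2 : graph n) (m : matching n) : rel 'I_n :=
  fun i j => [&& i \in mdom m, j \in mdom m,
                 adj G1 i j & adj G2 (mfun m i) (mfun m j)].

Definition kcore_matching (n k : nat) (G1 G2 : graph n) (m : matching n) : Prop :=
  forall i, i \in mdom m -> (k <= #|[set j | wedge G1 G2 m i j]|)%N.

Definition max_kcore_matching (n k : nat) (G1 G2 : graph n) (m : matching n) :
    Prop :=
  kcore_matching k G1 G2 m /\
  (forall m', kcore_matching k G1 G2 m' -> (#|mdom m'| <= #|mdom m|)%N).

(* Ties are broken by an arbitrary function of the pair of graphs. *)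
Definition kcore_estimator (n k : nat) (est : graph n -> graph n -> matching n) :
    Prop :=
  forall G1 G2, max_kcore_matching k G1 G2 (est G1 G2).

Definition recovers (n : nat) (m : matching n) (pi : 'S_n) : bool :=
  (mdom m == [set: 'I_n]) && [forall i, mfun m i == pi i].

Lemma adj_relabel (n : nat) (pi : 'S_n) (G : graph n) (i j : 'I_n) :
  adj (relabel pi G) (pi i) (pi j) = adj G i j.
Proof.
have symG (H : graph n) a b : adj H a b = adj H b a.
  by apply: eq_existsb => e; rewrite orbC.
apply/idP/idP.
  case/existsP=> e /andP[]; rewrite inE => + /orP[] /eqP E; rewrite E /= !permK //.
  by rewrite symG.
move=> Gij; have nij : i != j.
  case/existsP: Gij => -[[a b] /= lab] /andP[_ /=].
  by apply: contraTneq => ->; rewrite !xpair_eqE;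
     apply/negP => /orP[] /andP[/eqP ea /eqP eb]; move: lab; rewrite ea eb ltnn.
have : pi i != pi j by rewrite (inj_eq perm_inj).
rewrite neq_ltn => /orP[] h.
  apply/existsP; exists (exist _ (pi i, pi j) h).
  by rewrite inE /= !permK Gij eqxx.
apply/existsP; exists (exist _ (pi j, pi i) h).
by rewrite inE /= !permK symG Gij eqxx orbT.
Qed.

Lemma sum_random_subset_law (R : realType) (T : finType) (q : T -> R) :
  \sum_(A : {set T}) random_subset_law q A = 1.
Proof.
by rewrite /random_subset_law -bigA_distr big1 // => x _; rewrite [LHS]addrC subrK.
Qed.

Lemma sum_corr_law (R : realType) (n : nat) (p : 'I_n -> 'I_n -> R) (s : R) :
  \sum_(w : outcome n) corr_law p s w = 1.
Proof.
rewrite -(sum_random_subset_law (fun e : edge n => p (val e).1 (val e).2)).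
rewrite (eq_bigr (fun w : outcome n => irg_law p w.1.1.1
  * subsample_law s w.1.1.1 w.1.1.2 * subsample_law s w.1.1.1 w.1.2 / (n`!)%:R));
  last by case=> [[[]]].
rewrite -(pair_bigA _ (fun (x : graph n * graph n * graph n) (y : 'S_n) =>
  irg_law p x.1.1 * subsample_law s x.1.1 x.1.2 * subsample_law s x.1.1 x.2
    / (n`!)%:R)) /=.
under eq_bigr do rewrite sumr_const card_Sn -[_ *+ _]mulr_natr divfK ?pnatr_eq0
  -?lt0n ?fact_gt0 //.
rewrite -(pair_bigA _ (fun (x : graph n * graph n) (y : graph n) =>
  irg_law p x.1 * subsample_law s x.1 x.2 * subsample_law s x.1 y)) /=.
under eq_bigr do rewrite -mulr_sumr sum_random_subset_law mulr1.
rewrite -(pair_bigA _ (fun x y : graph n => irg_law p x * subsample_law s x y)) /=.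
by apply: eq_bigr => G _; rewrite -mulr_sumr sum_random_subset_law mulr1.
Qed.

(* Main.v *)
Require Import Defs.
From mathcomp Require Import all_boot all_order all_algebra all_fingroup.
From mathcomp Require Import all_classical all_reals all_analysis.
From mathcomp Require Import fintype finset zify ring lra.
Import Order.TTheory GRing.Theory Num.Theory.
Import numFieldNormedType.Exports.
Set Implicit Arguments.
Unset Strict Implicit.
Unset Printing Implicit Defensive.
Local Open Scope ring_scope.

(** Undoing the latent permutation [pi], compare [G1] with the unshuffled graph
    [G2']. The proof is a first-moment argument resting on two facts.

    Minimum degree. An edge is common to [G1] and [G2'] with probability
    [p_ij s ^ 2], so a vertex has expected common degree at least
    [(1 + epsilon) log n]. A Chernoff bound ([failure_prob_le], [star_gf_le])
    shows that it has fewer than [k] common edges with probability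
    [O(n ^ (- 1 - epsilon / 2))], hence with high probability every vertex has at
    least [k]. The true matching is then a [k]-core matching defined on all of
    [[n]], so every largest [k]-core matching is defined on [[n]] as well: only
    permutations have to be ruled out, not partial matchings ([not_recovered]).

    Wrong permutations. Let [t] be the wrong permutation, relative to [pi], and
    let [d > 0] be the number of vertices it moves. Each moved vertex has at least
    [k - 1] edges [e] of [G1] such that [t e] is an edge of [G2'] other than [e].
    Thinning this set of edges by a factor at most 3 yields a set [S] of
    [r d] edges, with [r] about [k / 6], disjoint from its image [t S]
    ([exists_disjoint_mismatches]). As [S] and [t S] consist of [2 r d] distinct
    edges of the parent graph, a given [S] occurs with probability at most
    [p_max ^ (2 r d)]. There are at most [(4 n) ^ (r d)] sets [S]
    ([bin_mul_le]) and at most [n ^ d] permutations [t] ([card_moved_eq]), so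
    the union bound gives the sum over [d >= 1] of
    [(n (4 n p_max ^ 2) ^ r) ^ d]. With [p_max <= n ^ (- alpha + o(1))] the ratio
    is [n ^ (1 - r (2 alpha - 1) + o(1))], which tends to 0 because the lower
    bound on [k] makes [r (2 alpha - 1) > 1] ([exponent_gt1]). *)

(** * Edges as two-element sets *)

Section Edges.
Local Open Scope nat_scope.
Variable n : nat.
Implicit Types (e : edge n) (i j : 'I_n) (s : 'S_n) (G : graph n).

Definition ends e : {set 'I_n} := [set (val e).1; (val e).2].

Lemma ends_eq e i j :
  (ends e == [set i; j]) = (val e == (i, j)) || (val e == (j, i)).
Proof.
case: e => -[a b] /= lab; rewrite /ends /= !xpair_eqE.
apply/eqP/orP => [E|[/andP[/eqP-> /eqP->]|/andP[/eqP-> /eqP->]]] //; last first.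
  by rewrite setUC.
have := set21 a b; have := set22 a b; rewrite E !inE.
have nab : a != b by apply: contraTneq lab => ->; rewrite ltnn.
case/orP=> /eqP ? /orP[] /eqP ?; subst; rewrite ?eqxx ?orbT ?andbT /=; auto.
all: by rewrite eqxx in nab.
Qed.

Lemma ends_inj : injective ends.
Proof.
move=> [[a b] /= lab] f /esym /eqP; rewrite ends_eq /= => /orP[] /eqP E.
  exact/esym/val_inj.
case: f E => f /= lf E; move: lf; rewrite E /= => lba.
by have := ltn_trans lab lba; rewrite ltnn.
Qed.

Lemma adj_ends G i j : adj G i j = [exists e in G, ends e == [set i; j]].
Proof. by apply: eq_existsb => e; rewrite ends_eq. Qed.

Lemma exists_edge i j : i != j -> exists e, ends e = [set i; j].
Proof.
rewrite neq_ltn => /orP[] lij; [exists (exist _ (i, j) lij)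
  | exists (exist _ (j, i) lij)]; apply/eqP; by rewrite ends_eq /= eqxx ?orbT.
Qed.

Lemma card_ends e : #|ends e| = 2.
Proof.
case: e => -[a b] /= lab; rewrite cards2.
by suff -> : a != b by []; apply: contraTneq lab => ->; rewrite ltnn.
Qed.

Definition star i : {set edge n} := [set e | i \in ends e].

Definition other i e : 'I_n := if (val e).1 == i then (val e).2 else (val e).1.

Lemma ends_other i e : e \in star i -> ends e = [set i; other i e].
Proof.
case: e => -[a b] lab; rewrite !inE /ends /other /= eq_sym.
by case: eqP => [-> //|_ /= /eqP->]; rewrite setUC.
Qed.

Lemma other_neq i e : e \in star i -> other i e != i.
Proof.
move=> /ends_other E; have := card_ends e; rewrite E cards2 eq_sym.
by case: (_ != _).
Qed.

Lemma ends_starE e i j : ends e = [set i; j] -> e \in star i /\ other i e = j.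
Proof.
move=> E; have ie : e \in star i by rewrite inE E set21.
split=> //; have := set22 i (other i e); rewrite -ends_other // E !inE.
by rewrite (negPf (other_neq ie)) => /eqP.
Qed.

Lemma other_inj i : {in star i &, injective (other i)}.
Proof.
move=> e f ei fi eq_o; apply: ends_inj.
by rewrite (ends_other ei) (ends_other fi) eq_o.
Qed.

Lemma imset_other_star i : other i @: star i = [set~ i].
Proof.
apply/setP=> j; rewrite !inE; apply/imsetP/idP => [[e ei ->]|nji].
  exact: other_neq.
have [e /ends_starE[ei <-]] : exists e, ends e = [set i; j].
  by apply: exists_edge; rewrite eq_sym.
by exists e.
Qed.

Lemma card_star_le i : #|star i| <= n.
Proof.
rewrite -(card_in_imset (@other_inj i)) -[X in _ <= X](card_ord n).
exact: max_card.
Qed.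

(** The action of a relabelling of the vertices on the edges; the default value
    of [insubd] is never used, as an edge has two distinct ends. *)
Definition relabel_edge s e : edge n :=
  insubd e (if s (val e).1 < s (val e).2 then (s (val e).1, s (val e).2)
            else (s (val e).2, s (val e).1)).

Lemma ends_relabel_edge s e : ends (relabel_edge s e) = s @: ends e.
Proof.
case: e => -[a b] /= lab; rewrite imsetU1 imset_set1 /=.
have nab : s a != s b.
  by rewrite (inj_eq perm_inj); apply: contraTneq lab => ->; rewrite ltnn.
apply/eqP; rewrite ends_eq insubdK /=; last first.
  rewrite unfold_in; case: ifP => //= /negbT.
  by rewrite -leqNgt leq_eqVlt val_eqE eq_sym (negPf nab).
by case: ifP; rewrite eqxx ?orbT.
Qed.

Lemma relabel_edge_inj s : injective (relabel_edge s).
Proof.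
move=> e f eq_ef; apply: ends_inj.
by apply: (imset_inj (@perm_inj _ s)); rewrite -!ends_relabel_edge eq_ef.
Qed.

Lemma mem_edge_adj G e i j : ends e = [set i; j] -> (e \in G) = adj G i j.
Proof.
move=> E; rewrite adj_ends; apply/idP/existsP => [eG|[f /andP[fG /eqP]]].
  by exists e; rewrite eG E eqxx.
by rewrite -E => /ends_inj <-.
Qed.

End Edges.

(** * Deterministic part *)

(** A maximal subset [B] of [A] that its image avoids works: every element of
    [A] lies in [B], in its image, or in its preimage. *)
Lemma image_disjoint_subset (T : finType) (h : T -> T) (A : {set T}) :
    injective h -> {in A, forall x, h x != x} ->
  exists B : {set T}, [/\ B \subset A, [disjoint B & h @: B]
    & (#|A| <= 3 * #|B|)%N].
Proof.
move=> hI hA.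
pose P (B : {set T}) := (B \subset A) && [disjoint B & h @: B].
have P0 : P set0 by rewrite /P sub0set -setI_eq0 set0I eqxx.
have [B /maxsetP[/andP[BA dB] maxB] _] := maxset_exists P0.
exists B; split=> //.
suff sAB : A \subset B :|: (h @: B :|: h @^-1: B).
  apply: leq_trans (subset_leq_card sAB) _.
  apply: leq_trans (leq_card_setU _ _) _; rewrite mulSn leq_add2l.
  apply: leq_trans (leq_card_setU _ _) _; rewrite mul2n -addnn leq_add //.
    exact: leq_imset_card.
  rewrite -(card_imset _ hI); apply/subset_leq_card/subsetP.
  by move=> _ /imsetP[x + ->]; rewrite inE.
apply/subsetP => x xA; rewrite !inE; apply: contraT.
rewrite !negb_or => /and3P[xB xhB hxB].
have /maxB-/(_ (subsetUr _ _)) E : P (x |: B).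
  rewrite /P subUset sub1set xA BA /= -setI_eq0; apply/eqP/setP => y.
  rewrite in_set0; apply/negP; rewrite inE imsetU1 => /andP[].
  rewrite !inE => /orP[/eqP->|yB] /orP[].
  - by rewrite eq_sym (negPf (hA _ xA)).
  - by rewrite (negPf xhB).
  - by move/eqP=> E; rewrite -E yB in hxB.
  by move=> yhB; move: dB; rewrite disjoint_sym => /disjointFr/(_ yhB); rewrite yB.
by rewrite -E setU11 in xB.
Qed.

Section Mismatches.
Local Open Scope nat_scope.
Variable n : nat.
Implicit Types (s : 'S_n) (G : graph n) (F : {set 'I_n}) (S : {set edge n}).

Definition moved s : {set 'I_n} := [set i | s i != i].

Definition touching F : {set edge n} := \bigcup_(i in F) star i.

Lemma card_touching F : #|touching F| <= #|F| * n.
Proof.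
rewrite /touching -sum_nat_const.
elim/big_rec2: _ => [|i m A _ IH]; first by rewrite cards0.
apply: leq_trans (leq_card_setU _ _) _; exact: leq_add (card_star_le _) IH.
Qed.

(** An edge fixed by [s], such as one joining two swapped vertices, is left out:
    to lie in both graphs it only has to be present once in the parent graph, which
    costs one factor [p_max] instead of two. *)
Definition mismatches s G1 G2 : {set edge n} :=
  [set e in G1 | (relabel_edge s e \in G2) && (relabel_edge s e != e)].

Lemma mismatches_touching s G1 G2 : mismatches s G1 G2 \subset touching (moved s).
Proof.
apply/subsetP => e; rewrite inE => /and3P[_ _]; apply: contraNT => /bigcupP he.
have fixe i : i \in ends e -> s i = i.
  move=> ie; apply: contraPeq he => nsi; apply; exists i; first by rewrite inE.
  by rewrite inE.
apply/eqP/ends_inj; rewrite ends_relabel_edge -[RHS]imset_id.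
by apply: eq_in_imset => i /fixe.
Qed.

(** A moved vertex [i] loses at most one neighbour, namely [s i], when the edges
    fixed by [s] are dropped; each remaining edge is counted from at most two
    moved vertices. *)
Lemma moved_le_mismatches k s G1 G2 :
    (forall i, k <= #|[set j | adj G1 i j && adj G2 (s i) (s j)]|) ->
  k.-1 * #|moved s| <= 2 * #|mismatches s G1 G2|.
Proof.
move=> hk; rewrite mulnC -sum_nat_const.
apply: (@leq_trans (\sum_(i in moved s) #|mismatches s G1 G2 :&: star i|)).
  apply: leq_sum => i; rewrite inE => nsi; rewrite -subn1 leq_subLR.
  apply: leq_trans (hk i) _.
  apply: leq_trans (_ :
    #|s i |: other i @: (mismatches s G1 G2 :&: star i)| <= _); last first.
    rewrite (cardsU1 (s i)); apply: leq_add; last exact: leq_imset_card.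
    by case: (_ \notin _).
  apply/subset_leq_card/subsetP => j; rewrite !inE => /andP[ij sij].
  case: (eqVneq j (s i)) => //= nj; apply/imsetP.
  move: ij; rewrite adj_ends => /existsP[e /andP[eG /eqP Ee]].
  have [ei oe] := ends_starE Ee; exists e => //.
  have Es : ends (relabel_edge s e) = [set s i; s j].
    by rewrite ends_relabel_edge Ee imsetU1 imset_set1.
  rewrite inE ei andbT inE eG (mem_edge_adj _ Es) sij /=.
  apply: contraNneq nj => E; have := set21 (s i) (s j).
  by rewrite -Es E Ee !inE (negPf nsi) eq_sym.
under eq_bigr do rewrite -sum1_card.
rewrite [X in X <= _](exchange_big_dep [in mismatches s G1 G2]) /=; last first.
  by move=> i e _ /setIP[].
rewrite mulnC -sum_nat_const; apply: leq_sum => e eM.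
rewrite sum1_card -(card_ends e); apply/subset_leq_card/subsetP => i.
by rewrite unfold_in => /andP[_ /setIP[_]]; rewrite inE.
Qed.

(** The constant 6 is 2, for the two ends of an edge, times 3, for the passage to
    a set disjoint from its image. Disjointness makes the edges of [S] and of its
    image pairwise distinct, hence independent in the parent graph. *)
Lemma exists_disjoint_mismatches k s G1 G2 :
    (forall i, k <= #|[set j | adj G1 i j && adj G2 (s i) (s j)]|) ->
  exists S, [/\ S \subset touching (moved s), #|S| = k.-1 %/ 6 * #|moved s|,
    [disjoint S & relabel_edge s @: S], S \subset G1
    & relabel_edge s @: S \subset G2].
Proof.
move=> /moved_le_mismatches hk.
have [|B [BM dB cB]] := image_disjoint_subset (@relabel_edge_inj n s)
    (A := mismatches s G1 G2).
  by move=> e; rewrite inE => /and3P[].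
have : k.-1 %/ 6 * #|moved s| <= #|B|.
  rewrite -(leq_pmul2l (isT : 0 < 6)) mulnA [6 * _]mulnC.
  apply: (@leq_trans (k.-1 * #|moved s|)); first by rewrite leq_mul2r leq_divM orbT.
  by apply: leq_trans hk _; rewrite -[6]/(2 * 3) -mulnA leq_mul2l.
case/card_geqP => l [ul sl lB].
have SB : [set x in l] \subset B by apply/subsetP => x; rewrite inE => /lB.
have SM := subset_trans SB BM.
exists [set x in l]; split.
- exact: subset_trans SM (mismatches_touching _ _ _).
- by rewrite cardsE -sl (card_uniqP ul).
- exact: disjointWl SB (disjointWr (imsetS _ SB) dB).
- by apply/subsetP => x /(subsetP SM); rewrite inE => /andP[].
- apply/subsetP => _ /imsetP[x /(subsetP SM) + ->].
  by rewrite inE => /and3P[].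
Qed.

(** If the true matching is itself a [k]-core matching, a largest one is defined
    on all vertices, hence is a permutation. *)
Lemma not_recovered (k : nat) (pi : 'S_n) G1 G2 (m : matching n) :
    max_kcore_matching k G1 (relabel pi G2) m -> ~~ recovers m pi ->
    (forall i, k <= #|[set j | adj G1 i j && adj G2 i j]|) ->
  exists2 s : 'S_n, s != 1%g
    & forall i, k <= #|[set j | adj G1 i j && adj G2 (s i) (s j)]|.
Proof.
move=> [km maxm] nrec hk.
have pi_inj : {in [set: 'I_n] &, injective pi} by move=> ? ? _ _; exact: perm_inj.
have /maxm /= : kcore_matching k G1 (relabel pi G2) (Matching pi_inj).
  move=> i _; apply: leq_trans (hk i) _; apply/subset_leq_card/subsetP => j.
  by rewrite !inE /wedge /= !in_setT adj_relabel.
rewrite cardsT card_ord => cm.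
have domT : mdom m = [set: 'I_n].
  by apply/eqP; rewrite eqEcard subsetT cardsT card_ord.
have mI : injective (Defs.mfun m).
  by move=> i j; apply: (mfun_inj (m := m)); rewrite domT in_setT.
pose s := (perm mI * pi^-1)%g.
have piE i : Defs.mfun m i = pi (s i) by rewrite /s permM permE permKV.
exists s.
  apply: contraNneq nrec => s1; rewrite /recovers domT eqxx /=.
  by apply/forallP => i; rewrite piE s1 perm1.
move=> i; have := km i; rewrite domT in_setT => /(_ isT) /leq_trans; apply.
apply/subset_leq_card/subsetP => j.
by rewrite !inE /wedge /= !piE adj_relabel domT !in_setT.
Qed.

Lemma common_degree_ge (k : nat) G1 G2 (i : 'I_n) :
    k <= #|star i :&: (G1 :&: G2)| ->
  k <= #|[set j | adj G1 i j && adj G2 i j]|.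
Proof.
move/leq_trans; apply.
rewrite -(card_in_imset (f := other i)); last first.
  by move=> e f; rewrite !in_setI => /andP[ei _] /andP[fi _]; exact: other_inj.
apply/subset_leq_card/subsetP => _ /imsetP[e + ->].
rewrite !in_setI => /and3P[/ends_other Ee e1 e2].
by rewrite inE -!(mem_edge_adj _ Ee) e1 e2.
Qed.

End Mismatches.

(** * Counting relabellings and candidate sets *)

(** Choosing the moved set and then a permutation of it gives at most
    ['C(n, d) * d`! = n ^_ d] permutations; the factor [d`!] in place of [n ^ d]
    is what keeps the count below [n ^ d] instead of [n ^ (2 d)]. *)
Lemma card_moved_eq (n d : nat) : (#|[set s : 'S_n | #|moved s| == d]| <= n ^ d)%N.
Proof.
apply: (@leq_trans (\sum_(F : {set 'I_n} | #|F| == d) #|perm_on F|)).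
  apply: leq_trans (_ :
    #|\bigcup_(F : {set 'I_n} | #|F| == d) [set s | perm_on F s]| <= _)%N.
    apply/subset_leq_card/subsetP => s; rewrite inE => ds.
    apply/bigcupP; exists (moved s) => //; rewrite inE.
    by apply/subsetP => i; rewrite !inE.
  elim/big_rec2: _ => [|F m A _ IH]; first by rewrite cards0.
  by apply: leq_trans (leq_card_setU _ _) _; rewrite cardsE leq_add2l.
under eq_bigr => F /eqP dF do rewrite card_perm dF.
have cd := card_draws 'I_n d; rewrite card_ord in cd.
rewrite sum_nat_cond_const [X in (X * _)%N](etrans _ cd) // bin_ffact.
elim: d {cd} => // d IH; rewrite ffactnSr expnSr leq_mul // leq_subr //.
Qed.

(** The denominator [t`!] cancels the factor [d]: since
    [t ^ t <= 'C(2 t, t) * t`!] and ['C(2 t, t) <= 4 ^ t], the coefficient is at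
    most [(4 d n / t) ^ t]. *)
Lemma bin_mul_le (n d t : nat) : (d <= t -> 'C(d * n, t) <= (4 * n) ^ t)%N.
Proof.
move=> dt; rewrite -(leq_pmul2r (fact_gt0 t)) bin_ffact.
have ffact_le m u : (m ^_ u <= m ^ u)%N.
  by elim: u => // u IH; rewrite ffactnSr expnSr leq_mul // leq_subr.
have le_ffact m : (t ^ m <= (t + m) ^_ m)%N.
  by elim: m => // m IH; rewrite addnS ffactSS expnS leq_mul // -addnS leq_addr.
have bin4 : ('C(t + t, t) <= 4 ^ t)%N.
  have := expnDn 1 1 (t + t); under eq_bigr do rewrite !exp1n !muln1.
  rewrite -[4%N]/(2 ^ 2)%N -expnM mul2n -addnn => ->.
  by rewrite (bigD1 (inord t)) //= inordK ?leq_addr // ltnS leq_addr.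
apply: leq_trans (ffact_le _ _) _.
apply: (@leq_trans ((t * n) ^ t)).
  by case: (posnP t) => [-> //|t0]; rewrite leq_exp2r // leq_mul2r dt orbT.
rewrite !expnMn mulnAC leq_mul2r; apply/orP; right.
by apply: leq_trans (le_ffact t) _; rewrite -bin_ffact leq_mul2r bin4 orbT.
Qed.

(** * The law of the correlated graphs *)

Section Law.
Variable R : realType.

(** Independence: a product over the elements integrates factor by factor. *)
Lemma random_subset_prod (T : finType) (q u v : T -> R) :
  \sum_(A : {set T}) random_subset_law q A
      * \prod_x (if x \in A then u x else v x)
    = \prod_x (q x * u x + (1 - q x) * v x).
Proof.
rewrite (bigA_distr _ _ (fun x => q x * u x) (fun x => (1 - q x) * v x)).
apply: eq_bigr => A _; rewrite -big_split /=; apply: eq_bigr => x _.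
by case: ifP.
Qed.

Lemma random_subset_law_ge0 (T : finType) (q : T -> R) (A : {set T}) :
  (forall x, 0 <= q x <= 1) -> 0 <= random_subset_law q A.
Proof.
move=> hq; apply: prodr_ge0 => x _; have /andP[q0 q1] := hq x.
by case: ifP; rewrite ?subr_ge0.
Qed.

Variables (n : nat) (p : 'I_n -> 'I_n -> R) (s : R).
Hypotheses (hp : edge_probs p) (hs : 0 <= s <= 1).
Implicit Types (G H : graph n) (C : {set edge n}) (w : outcome n).

Let pe (e : edge n) := p (val e).1 (val e).2.

Lemma edge_prob_itv (e : edge n) : 0 <= pe e <= 1.
Proof. by case: hp => + _ _; apply. Qed.

Lemma corr_law_ge0 w : 0 <= corr_law p s w.
Proof.
case: w => -[[G H1] H2] pi; rewrite /corr_law /irg_law /subsample_law.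
rewrite divr_ge0 ?ler0n // !mulr_ge0 // random_subset_law_ge0 //.
- exact: edge_prob_itv.
- by move=> e; case: ifP; rewrite // lexx ler01.
- by move=> e; case: ifP; rewrite // lexx ler01.
Qed.

Lemma subsample_law_eq0 G H : ~~ (H \subset G) -> subsample_law s G H = 0.
Proof.
case/subsetPn => e eH eG; rewrite /subsample_law /random_subset_law.
by rewrite (bigD1 e) //= eH (negPf eG) mul0r.
Qed.

Lemma corr_law_sum (f : graph n -> graph n -> graph n -> R) :
  \sum_w corr_law p s w * (let: (G, H1, H2, _) := w in f G H1 H2)
    = \sum_G irg_law p G * \sum_H1 subsample_law s G H1
        * \sum_H2 subsample_law s G H2 * f G H1 H2.
Proof.
pose g (x : graph n * graph n * graph n) :=
  irg_law p x.1.1 * subsample_law s x.1.1 x.1.2 * subsample_law s x.1.1 x.2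
    * f x.1.1 x.1.2 x.2.
rewrite (eq_bigr (fun w : outcome n => g w.1 / (n`!)%:R)); last first.
  by case=> [[[G H1] H2] pi] _; rewrite /corr_law /g /= mulrAC.
rewrite -(pair_bigA _ (fun x (y : 'S_n) => g x / (n`!)%:R)) /=.
under eq_bigr do rewrite sumr_const card_Sn -[_ *+ _]mulr_natr divfK ?pnatr_eq0
  -?lt0n ?fact_gt0 //.
rewrite -(pair_bigA _ (fun (x : graph n * graph n) (y : graph n) => g (x, y))) /=.
rewrite -(pair_bigA _ (fun x y : graph n => \sum_H2 g (x, y, H2))) /=.
apply: eq_bigr => G _; rewrite mulr_sumr; apply: eq_bigr => H1 _.
by rewrite !mulr_sumr; apply: eq_bigr => H2 _; rewrite /g /= -!mulrA.
Qed.

Lemma prob_subset_parent C :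
  \sum_w corr_law p s w * (let: (G, _, _, _) := w in (C \subset G)%:R)
    = \prod_(e in C) pe e.
Proof.
rewrite (corr_law_sum (fun G _ _ => (C \subset G)%:R)).
under [LHS]eq_bigr => G _.
  under eq_bigr => H1 _ do rewrite -mulr_suml sum_random_subset_law mul1r.
  rewrite -mulr_suml sum_random_subset_law mul1r.
  have -> : (C \subset G)%:R =
      \prod_e (if e \in G then 1 else (e \notin C)%:R) :> R.
    case: (boolP (C \subset G)) => [/subsetP CG|/subsetPn[e eC eG]].
      rewrite big1 // => e _; case: ifP => // /negbT eG.
      by rewrite (contra (CG e) eG).
    by rewrite (bigD1 e) //= (negPf eG) eC mul0r.
  over.
rewrite random_subset_prod [RHS]big_mkcond /=; apply: eq_bigr => e _.
by case: ifP; rewrite !(mulr1, mulr0) ?addr0 // addrC subrK.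
Qed.

Lemma edge_prob_le_max (e : edge n) : pe e <= p_max p.
Proof.
rewrite /p_max; apply: le_trans (le_bigmax _ _ (val e).1).
exact: (le_bigmax _ (fun j => p (val e).1 j)).
Qed.

Lemma prob_subset_parent_le C :
  \sum_w corr_law p s w * (let: (G, _, _, _) := w in (C \subset G)%:R)
    <= p_max p ^+ #|C|.
Proof.
rewrite prob_subset_parent -prodr_const; apply: ler_prod => e _.
by case/andP: (edge_prob_itv e) => -> _; exact: edge_prob_le_max.
Qed.

(** An edge is common with probability [p s ^ 2], so that it contributes the factor
    [1 - p s ^ 2 + z p s ^ 2] to the generating function of the number of common
    edges in [C]. *)
Lemma common_edges_gf C (z : R) :
  \sum_w corr_law p s w
      * (let: (_, H1, H2, _) := w in z ^+ #|C :&: (H1 :&: H2)|)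
    = \prod_(e in C) (1 - (1 - z) * (pe e * s ^+ 2)).
Proof.
rewrite (corr_law_sum (fun _ H1 H2 => z ^+ #|C :&: (H1 :&: H2)|)).
pose u e : R := if e \in C then z else 1.
have mean_indic (a b : R) : a * b + (1 - a) * 1 = 1 - a * (1 - b) by ring.
under [LHS]eq_bigr => G _.
  under eq_bigr => H1 _.
    under eq_bigr => H2 _.
      have -> : z ^+ #|C :&: (H1 :&: H2)| = \prod_e (if e \in H2 then
          (if e \in H1 then u e else 1) else 1).
        rewrite -prodr_const big_mkcond /=; apply: eq_bigr => e _.
        by rewrite !inE /u; do 3!case: (_ \in _).
      over.
    rewrite random_subset_prod.
    rewrite (eq_bigr (fun e => if e \in H1 then
        1 - (if e \in G then s else 0) * (1 - u e) else 1)); last first.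
      move=> e _; rewrite mean_indic; case: (e \in H1) => //.
      by rewrite subrr mulr0 subr0.
    over.
  rewrite random_subset_prod.
  rewrite (eq_bigr (fun e => if e \in G then 1 - s ^+ 2 * (1 - u e) else 1)); last first.
    move=> e _; rewrite mean_indic subKr.
    by case: (e \in G); rewrite ?mul0r ?subr0 // mulrA -expr2.
  over.
rewrite random_subset_prod [RHS]big_mkcond /=; apply: eq_bigr => e _.
rewrite mean_indic subKr /u; case: (e \in C).
  by rewrite mulrA mulrC.
by rewrite subrr !mulr0 subr0.
Qed.

End Law.

(** * The failure probability for fixed [n] *)

Section Failure.
Variable R : realType.

Lemma sum_moved_le (n : nat) (y : R) : 0 <= y ->
  \sum_(s : 'S_n | s != 1%g) y ^+ #|moved s| <= \sum_(d < n) (n%:R * y) ^+ d.+1.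
Proof.
move=> y0.
apply: (@le_trans _ _ (\sum_(s : 'S_n) \sum_(d < n)
    (#|moved s| == d.+1)%:R * y ^+ d.+1)).
  rewrite [leRHS](bigID (fun s : 'S_n => s != 1%g)) /=.
  have terms_ge0 (s : 'S_n) (d : 'I_n) : 0 <= (#|moved s| == d.+1)%:R * y ^+ d.+1.
    by rewrite mulr_ge0 ?ler0n ?exprn_ge0.
  rewrite ler_wpDr ?sumr_ge0 // => [s _|]; first exact: sumr_ge0.
  apply: ler_sum => s ns1; have m_gt0 : (0 < #|moved s|)%N.
    rewrite lt0n cards_eq0; apply: contraNneq ns1 => m0.
    apply/eqP/permP => i; rewrite perm1; apply/eqP.
    by have := in_set0 i; rewrite -m0 inE => /negbFE.
  have m_le : (#|moved s|.-1 < n)%N.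
    by rewrite prednK // -[X in (_ <= X)%N](card_ord n) max_card.
  rewrite (bigD1 (Ordinal m_le)) //= prednK // eqxx mul1r.
  by rewrite lerDl sumr_ge0.
rewrite exchange_big /=; apply: ler_sum => d _.
rewrite -mulr_suml exprMn ler_wpM2r ?exprn_ge0 // -natr_sum -natrX ler_nat.
apply: leq_trans (card_moved_eq n d.+1).
rewrite -sum1_card [leqRHS]big_mkcond /=; apply: leq_sum => t _.
by rewrite inE; case: (_ == _).
Qed.

Variables (n k : nat) (p : 'I_n -> 'I_n -> R) (s : R).
Variable est : graph n -> graph n -> matching n.
Hypotheses (hp : edge_probs p) (hs : 0 <= s <= 1).
Hypothesis est_kcore : kcore_estimator k est.

Let r := (k.-1 %/ 6)%N.

Definition candidates (t : 'S_n) : {set {set edge n}} :=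
  [set S : {set edge n} | (S \subset touching (moved t))
     && (#|S| == r * #|moved t|)%N & [disjoint S & relabel_edge t @: S]].

Lemma card_candidates (t : 'S_n) : (0 < r)%N ->
  (#|candidates t| <= (4 * n) ^ (r * #|moved t|))%N.
Proof.
move=> r0; apply: leq_trans (bin_mul_le _ (leq_pmull _ r0)).
apply: leq_trans (leq_bin2l _ (card_touching (moved t))).
rewrite -cards_draws; apply/subset_leq_card/subsetP => S.
by rewrite !inE => /andP[].
Qed.

Lemma p_max_ge0 : 0 <= p_max p.
Proof. by rewrite /p_max; elim/big_rec: _ => // i x _ x0; rewrite le_max x0 orbT. Qed.

(** Only membership in the parent graph [G] is retained from [S] being in [G1] and
    its image in [G2']: this already costs [p_max] for each of the [2 r d] edges,
    and avoids the dependence between [G1] and [G2']. *)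
Lemma prob_candidates_le : (0 < r)%N ->
  \sum_w corr_law p s w * (\sum_(t : 'S_n | t != 1%g) \sum_(S in candidates t)
      (let: (G, _, _, _) := w in (S :|: relabel_edge t @: S \subset G)%:R))
    <= \sum_(d < n) (n%:R * (4 * n%:R * p_max p ^+ 2) ^+ r) ^+ d.+1.
Proof.
move=> r0; have P0 := p_max_ge0.
apply: le_trans (sum_moved_le _ _); last first.
  by rewrite exprn_ge0 // !mulr_ge0 ?exprn_ge0.
under eq_bigr do rewrite mulr_sumr.
rewrite exchange_big /=; apply: ler_sum => t _.
under eq_bigr do rewrite mulr_sumr.
rewrite exchange_big /=.
apply: (@le_trans _ _ (\sum_(S in candidates t) p_max p ^+ (2 * (r * #|moved t|)))).
  apply: ler_sum => S; rewrite inE => /andP[/andP[_ /eqP cS] dS].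
  apply: le_trans (prob_subset_parent_le s hp _) _.
  rewrite cardsU (card_imset _ (@relabel_edge_inj _ t)).
  by move: dS; rewrite -setI_eq0 => /eqP->; rewrite cards0 subn0 addnn -mul2n cS.
rewrite sumr_const -[leRHS]exprM (exprM _ 2) -[leLHS]mulr_natl [leRHS]exprMn.
rewrite ler_wpM2r ?exprn_ge0 // -natrM -natrX ler_nat.
exact: card_candidates.
Qed.

(** Failure requires either a vertex of common degree [m < k], for which
    [z ^ (m - k) >= 1], or a candidate set contained, with its image, in the parent
    graph. *)
Lemma failure_indicator_le (z : R) (w : outcome n) : 0 < z <= 1 ->
  corr_law p s w * (let: (G, H1, H2, pi) := w in
      ~~ recovers (est H1 (relabel pi H2)) pi)%:R <=
  corr_law p s w * ((\sum_(i < n)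
        z ^- k * (let: (_, H1, H2, _) := w in z ^+ #|star i :&: (H1 :&: H2)|))
    + \sum_(t : 'S_n | t != 1%g) \sum_(S in candidates t)
      (let: (G, _, _, _) := w in (S :|: relabel_edge t @: S \subset G)%:R)).
Proof.
move=> /andP[z0 z1]; case: w => -[[G H1] H2] pi.
have sum1_ge0 : 0 <= \sum_(i < n) z ^- k * z ^+ #|star i :&: (H1 :&: H2)|.
  by apply: sumr_ge0 => i _; rewrite mulr_ge0 ?invr_ge0 ?exprn_ge0 // ltW.
have sum2_ge0 : 0 <= \sum_(t : 'S_n | t != 1%g) \sum_(S in candidates t)
    ((S :|: relabel_edge t @: S \subset G)%:R : R).
  by apply: sumr_ge0 => t _; apply: sumr_ge0 => S _.
have [H1G|/subsample_law_eq0 E] := boolP (H1 \subset G); last first.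
  by rewrite /corr_law E mulr0 !mul0r.
have [H2G|/subsample_law_eq0 E] := boolP (H2 \subset G); last first.
  by rewrite /corr_law E mulr0 !mul0r.
rewrite ler_wpM2l ?corr_law_ge0 //; case: (boolP (recovers _ _)) => [_|nrec].
  exact: addr_ge0.
have [/forallP hk|/forallPn[i]] :=
    boolP [forall i, k <= #|star i :&: (H1 :&: H2)|]%N; last first.
  rewrite -ltnNge => lt_k; rewrite ler_wpDr //.
  rewrite (bigD1 i) //= ler_wpDr ?sumr_ge0 // => [j _|].
    by rewrite mulr_ge0 ?invr_ge0 ?exprn_ge0 // ltW.
  rewrite mulrC ler_pdivlMr ?exprn_gt0 // mul1r.
  exact: ler_wiXn2l (ltW z0) z1 _ _ (ltnW lt_k).
have [t nt1 ht] := not_recovered (est_kcore _ _) nrec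
  (fun i => common_degree_ge (hk i)).
have [S [ST cS dS S1 S2]] := exists_disjoint_mismatches ht.
rewrite ler_wpDl // (bigD1 t) //= ler_wpDr ?sumr_ge0 // => [u _|].
  exact: sumr_ge0.
rewrite (bigD1 S) /=; last by rewrite inE ST dS cS eqxx.
rewrite ler_wpDr ?sumr_ge0 // subUset.
by rewrite (subset_trans S1 H1G) (subset_trans S2 H2G).
Qed.

Lemma failure_prob_le (z : R) : 0 < z <= 1 -> (0 < r)%N ->
  1 - corr_prob p s (fun G1 G2 pi => recovers (est G1 G2) pi) <=
    \sum_(i < n) z ^- k * \prod_(e in star i)
        (1 - (1 - z) * (p (val e).1 (val e).2 * s ^+ 2))
    + \sum_(d < n) (n%:R * (4 * n%:R * p_max p ^+ 2) ^+ r) ^+ d.+1.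
Proof.
move=> hz r0.
apply: (@le_trans _ _ (\sum_w corr_law p s w *
    (let: (G, H1, H2, pi) := w in ~~ recovers (est H1 (relabel pi H2)) pi)%:R)).
  rewrite -[X in X - _](sum_corr_law p s) /corr_prob lerBlDr [X in _ + X]big_mkcond /=.
  rewrite -big_split /=; apply: ler_sum => -[[[G H1] H2] pi] _ /=.
  by case: (recovers _ _); rewrite /= ?mulr0 ?add0r ?mulr1 ?addr0.
apply: le_trans (ler_sum _ (fun w _ => failure_indicator_le w hz)) _.
under eq_bigr do rewrite mulrDr.
rewrite big_split /= lerD ?prob_candidates_le //.
under eq_bigr do rewrite mulr_sumr.
rewrite exchange_big /= le_eqVlt; apply/orP; left; apply/eqP.
apply: eq_bigr => i _; rewrite -common_edges_gf mulr_sumr.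
by apply: eq_bigr => w _; rewrite mulrCA.
Qed.

End Failure.

(** * Estimates as [n] grows *)

Section Asymptotics.
Variable R : realType.

Lemma sum_star (n : nat) (p : 'I_n -> 'I_n -> R) (i : 'I_n) :
  edge_probs p -> \sum_(e in star i) p (val e).1 (val e).2 = \sum_j p i j.
Proof.
case=> _ psym pii; rewrite [RHS](bigD1 i) //= pii add0r.
rewrite (eq_bigl [in other i @: star i]) => [|j]; last first.
  by rewrite imset_other_star !inE.
rewrite (big_imset _ (@other_inj _ i)) /=; apply: eq_bigr => e /ends_other/eqP.
by rewrite ends_eq => /orP[] /eqP-> //=; rewrite psym.
Qed.

(** [1 - x <= exp (- x)] turns the product into the expected degree. *)
Lemma star_gf_le (n : nat) (p : 'I_n -> 'I_n -> R) (s z l : R) (i : 'I_n) :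
    edge_probs p -> 0 <= s <= 1 -> 0 < z <= 1 ->
    l <= \sum_j p i j * s ^+ 2 ->
  \prod_(e in star i) (1 - (1 - z) * (p (val e).1 (val e).2 * s ^+ 2))
    <= expR (- ((1 - z) * l)).
Proof.
move=> hp /andP[s0 s1] /andP[z0 z1] hl.
apply: (@le_trans _ _ (\prod_(e in star i)
    expR (- ((1 - z) * (p (val e).1 (val e).2 * s ^+ 2))))).
  apply: ler_prod => e _; rewrite expR_ge1Dx andbT subr_ge0.
  case: hp => /(_ (val e).1 (val e).2) /andP[p0 p1] _ _.
  have s21 : s ^+ 2 <= 1 by rewrite expr_le1.
  have s20 : 0 <= s ^+ 2 by rewrite exprn_ge0.
  apply: mulr_ile1; rewrite ?mulr_ge0 ?subr_ge0 ?mulr_ile1 //.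
  by rewrite lerBlDr lerDl ltW.
rewrite -expR_sum ler_expR sumrN lerN2 -mulr_sumr -mulr_suml sum_star //.
by rewrite ler_wpM2l ?subr_ge0 // mulr_suml.
Qed.

Lemma geometric_le (n : nat) (x : R) : 0 <= x <= 1 / 2 ->
  \sum_(d < n) x ^+ d.+1 <= 2 * x.
Proof.
move=> /andP[x0 x1]; under eq_bigr do rewrite exprS.
rewrite -mulr_sumr mulrC ler_wpM2r //.
elim: n => [|n IH]; first by rewrite big_ord0.
rewrite big_ord_recl expr0; under eq_bigr do rewrite exprS.
rewrite -mulr_sumr.
have : x * \sum_(i < n) x ^+ i <= 1 / 2 * 2.
  by apply: ler_pM => //; apply: sumr_ge0 => i _; rewrite exprn_ge0.
lra.
Qed.

Lemma cvg_powRN (c : R) : 0 < c ->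
  ((n%:R : R) `^ (- c) @[n --> \oo] --> (0 : R))%classic.
Proof.
move=> c0; apply/cvgrPdist_lt => e e0.
near=> n; rewrite sub0r normrN ger0_norm ?powR_ge0 // powRN.
rewrite -[ltRHS]invrK ltf_pV2 ?posrE ?invr_gt0 ?powR_gt0 //; last first.
  by rewrite ltr0n; near: n; exact: nbhs_infty_gt.
have -> : e^-1 = (e^-1 `^ c^-1) `^ c.
  by rewrite -powRrM mulVf ?gt_eqF // powRr1 // invr_ge0 ltW.
apply: gt0_ltr_powR; rewrite ?nnegrE ?powR_ge0 ?ler0n //.
near: n; exact: nbhs_infty_gtr.
Unshelve. all: by end_near. Qed.

End Asymptotics.

Section Conclusion.
Variable R : realType.

(** The rounding in [k.-1 %/ 6] loses at most 1 against [k / 6], so the quotient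
    is at least [k / 6 - 1 > 2 / (2 alpha - 1) - 1], and the last bound is at least
    [1 / (2 alpha - 1)] because [2 alpha - 1 <= 1]. *)
Lemma exponent_gt1 (alpha : R) (k : nat) :
    1 / 2 < alpha <= 1 -> 12 / (2 * alpha - 1) < k%:R ->
  1 < (k.-1 %/ 6)%:R * (2 * alpha - 1).
Proof.
move=> /andP[a0 a1]; set b := 2 * alpha - 1.
have b0 : 0 < b by rewrite /b; lra.
have b1 : b <= 1 by rewrite /b; lra.
rewrite ltr_pdivrMr // => hk.
have : (k <= 6 * (k.-1 %/ 6) + 6)%N.
  have := divn_eq k.-1 6; have := @ltn_pmod k.-1 6 isT; lia.
rewrite -(ler_nat R) natrD natrM => /(ler_wpM2r (ltW b0)); lra.
Qed.

Lemma mismatch_rate (n r : nat) (P u : R) : (0 < n)%N ->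
    0 <= P <= n%:R `^ u ->
  n%:R * (4 * n%:R * P ^+ 2) ^+ r <= 4 ^+ r * n%:R `^ (1 + r%:R * (1 + 2 * u)).
Proof.
move=> n0 /andP[P0 Pu].
apply: (@le_trans _ _ (n%:R * (4 * n%:R * (n%:R `^ u) ^+ 2) ^+ r)).
  rewrite ler_wpM2l // lerXn2r ?nnegrE ?mulr_ge0 ?exprn_ge0 ?powR_ge0 //.
  by rewrite ler_wpM2l ?mulr_ge0 // lerXn2r ?nnegrE ?powR_ge0.
have nz : n%:R != 0 :> R by rewrite pnatr_eq0 -lt0n.
have nE : n%:R = expR (ln n%:R) :> R by rewrite lnK // posrE ltr0n.
rewrite /powR (negPf nz) -!expRM_natl -mulrA exprMn.
rewrite {1 2}nE -expRD -expRM_natl mulrCA -expRD.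
by rewrite le_eqVlt; apply/orP; left; apply/eqP; congr (_ * expR _); ring.
Qed.

(** The factor [n] is the union bound over the vertices. *)
Lemma degree_rate (n : nat) (a : R) : (0 < n)%N ->
  n%:R * expR (- ((1 + a) * ln n%:R)) = n%:R `^ (- a).
Proof.
move=> n0; have nz : n%:R != 0 :> R by rewrite pnatr_eq0 -lt0n.
have nE : n%:R = expR (ln n%:R) :> R by rewrite lnK // posrE ltr0n.
by rewrite /powR (negPf nz) {1}nE -expRD; congr expR; ring.
Qed.

Lemma corr_prob_le1 (n : nat) (p : 'I_n -> 'I_n -> R) (s : R) A :
  edge_probs p -> 0 <= s <= 1 -> corr_prob p s A <= 1.
Proof.
move=> hp hs; rewrite -[leRHS](sum_corr_law p s) /corr_prob big_mkcond /=.
by apply: ler_sum => w _; case: ifP => // _; exact: corr_law_ge0.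
Qed.

End Conclusion.

Local Open Scope classical_set_scope.
Local Open Scope ring_scope.

Theorem theorem1 (R : realType)
    (p : forall n : nat, 'I_n -> 'I_n -> R) (s : nat -> R)
    (alpha epsilon : R) (k : nat)
    (est : forall n : nat, graph n -> graph n -> matching n)
    (p_prob : forall n : nat, edge_probs (p n))
    (s_prob : forall n : nat, 0 <= s n <= 1)
    (alpha_range : 1 / 2 < alpha <= 1)
    (p_max_le : exists eps : nat -> R,
       (eps n @[n --> \oo] --> (0 : R)) /\
       forall n : nat, p_max (p n) <= n%:R `^ (- alpha + eps n))
    (k_gt0 : (0 < k)%N)
    (k_gt : 12 / (2 * alpha - 1) < k%:R)
    (epsilon_gt0 : 0 < epsilon)
    (min_degree : forall (n : nat) (i : 'I_n),
       (1 + epsilon) * ln n%:R <= \sum_(j < n) p n i j * s n ^+ 2)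
    (est_kcore : forall n : nat, kcore_estimator k (est n)) :
  corr_prob (p n) (s n) (fun G1 G2 pi => recovers (est n G1 G2) pi)
    @[n --> \oo] --> (1 : R).
Proof.
case: p_max_le => eps [eps_cvg eps_le].
pose r := (k.-1 %/ 6)%N.
have rate_gt1 : 1 < r%:R * (2 * alpha - 1) := exponent_gt1 alpha_range k_gt.
have r_gt0 : (0 < r)%N.
  by rewrite lt0n; apply: contraTneq rate_gt1 => ->; rewrite mul0r ltr10.
pose gamma := r%:R * (2 * alpha - 1) - 1.
have gamma_gt0 : 0 < gamma by rewrite subr_gt0.
(* The Chernoff parameter: small enough for the exponent
   [(1 - z) (1 + epsilon)] to exceed 1, and constant so that [z ^- k] is [O(1)]. *)
pose z := epsilon / (2 * (1 + epsilon)).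
have z_itv : 0 < z <= 1.
  rewrite /z divr_gt0 ?mulr_gt0 ?addr_gt0 //=.
  by rewrite ler_pdivrMr ?mulr_gt0 ?addr_gt0 // mul1r; lra.
have zE : (1 - z) * (1 + epsilon) = 1 + epsilon / 2.
  by rewrite /z; field; lra.
pose deg n : R := z ^- k * n%:R `^ (- (epsilon / 2)).
pose mis n : R := 4 ^+ r * n%:R `^ (- (gamma / 2)).
have deg_cvg : deg n @[n --> \oo] --> (0 : R).
  rewrite -[X in _ --> X](mulr0 (z ^- k)); apply: cvgMr.
  by apply: cvg_powRN; rewrite divr_gt0.
have mis_cvg : mis n @[n --> \oo] --> (0 : R).
  rewrite -[X in _ --> X](mulr0 (4 ^+ r)); apply: cvgMr.
  by apply: cvg_powRN; rewrite divr_gt0.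
apply: (squeeze_cvgr (f := fun n => 1 - (deg n + 2 * mis n)) (h := cst 1)).
- near=> n; rewrite corr_prob_le1 // andbT lerBlDr -lerBlDl.
  have n_gt0 : (0 < n)%N by near: n; exact: nbhs_infty_gt.
  apply: le_trans (failure_prob_le (p_prob n) (s_prob n) (est_kcore n)
    z_itv r_gt0) _.
  apply: lerD.
    apply: (@le_trans _ _ (\sum_(i < n) z ^- k *
        expR (- ((1 + epsilon / 2) * ln n%:R)))).
      apply: ler_sum => i _; case/andP: (z_itv) => z0 _.
      rewrite ler_wpM2l ?invr_ge0 ?exprn_ge0 ?(ltW z0) // -zE -mulrA.
      exact: star_gf_le.
    by rewrite sumr_const card_ord -[leLHS]mulr_natl mulrCA degree_rate.
  have small : mis n <= 1 / 2.
    by near: n; apply: cvgr_le mis_cvg _ _; rewrite divr_gt0.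
  have eps_small : eps n <= gamma / (4 * r%:R).
    by near: n; apply: cvgr_le eps_cvg _ _; rewrite divr_gt0 ?mulr_gt0 ?ltr0n.
  have x_le : n%:R * (4 * n%:R * p_max (p n) ^+ 2) ^+ r <= mis n.
    have p_itv : 0 <= p_max (p n) <= n%:R `^ (- alpha + eps n).
      by rewrite p_max_ge0 eps_le.
    apply: le_trans (mismatch_rate r n_gt0 p_itv) _.
    rewrite ler_wpM2l ?exprn_ge0 // ler_powR ?ler1n //.
    move: eps_small; rewrite ler_pdivlMr ?mulr_gt0 ?ltr0n // /gamma.
    by lra.
  apply: le_trans (geometric_le _ _) _; last by rewrite ler_wpM2l.
  rewrite (le_trans x_le small) andbT mulr_ge0 // exprn_ge0 //.
  by rewrite !mulr_ge0 ?exprn_ge0 ?p_max_ge0.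
- rewrite -[X in _ --> X]subr0; apply: cvgB; first exact: cvg_cst.
  rewrite -[X in _ --> X](addr0 0); apply: cvgD => //.
  by rewrite -[X in _ --> X](mulr0 2); apply: cvgMr.
- exact: cvg_cst.
Unshelve. all: by end_near. Qed.
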